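(* Assume $q \in D_0$ and, for each $i\in\{1,2\}$, $q\bmod n_i$ is a quadratic residue modulo $n_i$. For $(i,j,h)\in\{0,1\}^3$ let $\mathcal{D}_{(i,j,h)}$ be the cyclic code of length $n$ over $\mathrm{GF}(q)$ with generator polynomial $d_i(x)d_j^{(n_1)}(x)d_h^{(n_2)}(x)$. Then each $\mathcal{D}_{(i,j,h)}$ has length $n$ and dimension $(n+1)/2$, and its minimum odd-like weight $d_{(i,j,h)}$ satisfies $d_{(i,j,h)}\ge\sqrt n$. Moreover, if $n_1\equiv -1\pmod 8$ and $n_2\equiv -1\pmod 8$, then $d_{(i,j,h)}^2-d_{(i,j,h)}+1\ge n$.
   Context: Let $n_1,n_2$ be distinct odd primes, $n=n_1n_2$, and let $q$ be a prime power with $\gcd(q,n)=1$. Let $d=\gcd(n_1-1,n_2-1)$ and $e=(n_1-1)(n_2-1)/d$. Let $g_1,g_2$ be primitive roots modulo $n_1,n_2$ respectively, let $g$ be the integer modulo $n$ with $g\equiv g_1 \pmod{n_1}$, $g\equiv g_2\pmod{n_2}$, and let $\nu$ be the integer modulo $n$ with $\nu\equiv g\pmod{n_1}$, $\nu\equiv 1\pmod{n_2}$. It is known that every element of $\mathbb{Z}_n^*$ can be written uniquely as $g^s\nu^i$ with $0\le s\le e-1$, $0\le i\le d-1$. Define $D_0=\{g^{2s}\nu^i: 0\le s\le (e-2)/2,\ 0\le i\le d-1\}$ and $D_1=\{g^{2s+1}\nu^i: 0\le s\le (e-2)/2,\ 0\le i\le d-1\}$. For $j\in\{1,2\}$ let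 $D_0^{(n_j)}$, $D_1^{(n_j)}$ be the sets of quadratic residues and nonresidues modulo $n_j$. Let $N=\mathrm{ord}_n(q)$ and $\theta$ a primitive $n$-th root of unity in $\mathrm{GF}(q^N)$. Define $d_i(x)=\prod_{j\in D_i}(x-\theta^j)$, $d_i^{(n_1)}(x)=\prod_{j\in D_i^{(n_1)}}(x-\theta^{n_2 j})$, $d_i^{(n_2)}(x)=\prod_{j\in D_i^{(n_2)}}(x-\theta^{n_1 j})$ for $i\in\{0,1\}$; under the hypotheses these lie in $\mathrm{GF}(q)[x]$. Cyclic codes of length $n$ are identified with ideals of $\mathrm{GF}(q)[x]/(x^n-1)$. A codeword $(c_0,\dots,c_{n-1})$ is odd-like if $\sum_i c_i\neq 0$; the minimum odd-like weight is the minimum Hamming weight of odd-like codewords. *)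

(* Defs.v *)
From HB Require Import structures.
From mathcomp Require Import all_boot all_order all_algebra all_field.
Set Implicit Arguments. Unset Strict Implicit. Unset Printing Implicit Defensive.
Import GRing.Theory.
Local Open Scope ring_scope.

Definition is_primroot (m g : nat) : bool :=
  coprime g m &&
  [forall k : 'I_(totient m), (0 < k)%N ==> (g ^ k %% m != 1 %% m)%N].

Definition qr_mod (p x : nat) : bool :=
  (0 < x %% p)%N && [exists y : 'I_p, (y ^ 2 %% p == x %% p)%N].

Definition qclass (p : nat) (b : bool) (x : nat) : bool :=
  (0 < x %% p)%N && (qr_mod p x == ~~ b).

Definition cyc_class (n e d g nu : nat) (b : bool) (x : nat) : bool :=
  [exists s : 'I_e, exists i : 'I_d,
     (s <= (e - 2)./2)%N && (x %% n == (g ^ (2 * s + b) * nu ^ i) %% n)%N].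

Definition dpoly (L : fieldType) (n e d g nu : nat) (theta : L) (b : bool) : {poly L} :=
  \prod_(j < n | cyc_class n e d g nu b j) ('X - (theta ^+ j)%:P).

(* d_b^{(p)}(x) = prod_{j in D_b^{(p)}} (x - theta^(m j)), m the other prime *)
Definition dpoly_p (L : fieldType) (p m : nat) (theta : L) (b : bool) : {poly L} :=
  \prod_(j < p | qclass p b j) ('X - (theta ^+ (m * j))%:P).

Definition poly_row (F : fieldType) (n : nat) (p : {poly F}) : 'rV[F]_n :=
  \row_(i < n) p`_i.

(* the cyclic code of length n generated by gF: the ideal <gF> of F[x]/(x^n-1),
   i.e. the F-span of the x^k gF mod (x^n - 1) *)
Definition cyclic_code (F : fieldType) (n : nat) (gF : {poly F}) : {vspace 'rV[F]_n} :=
  <<[seq poly_row n (('X ^+ k * gF) %% ('X ^+ n - 1)) | k <- iota 0 n]>>%VS.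

Definition hwt (F : fieldType) (n : nat) (c : 'rV[F]_n) : nat :=
  #|[set i : 'I_n | c 0 i != 0]|.

Definition oddlike (F : fieldType) (n : nat) (c : 'rV[F]_n) : bool :=
  (\sum_(i < n) c 0 i != 0).

(* minimum Hamming weight of odd-like codewords (default n if there is none) *)
Definition min_oddlike_wt (F : finFieldType) (n : nat) (C : {vspace 'rV[F]_n}) : nat :=
  \big[minn/n]_(c : 'rV[F]_n | (c \in C) && oddlike c) hwt c.

(* Main.v *)
Require Import Defs.
From HB Require Import structures.
From mathcomp Require Import all_boot all_order all_algebra all_field.
From mathcomp Require Import cyclic zify.
Import GRing.Theory.
Local Open Scope ring_scope.

(* Modulo n2 the element nu is trivial, so D_b consists of the units whose
   quadratic class modulo n2 is b. Hence if r is a nonresidue modulo both n1 and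
   n2, then x -> r x exchanges the exponent set T of the zeros of the code with
   the complement of T and 0, which gives the dimension. For an odd-like codeword
   c the product c(x) c(x^r) then vanishes at every n-th root of unity except 1,
   so it is a nonzero multiple of 1 + x + ... + x^(n-1) modulo x^n - 1, and
   every residue modulo n is i1 + r i2 with i1, i2 in the support of c. For the
   square root bound one takes r = g; if n1 = n2 = 7 modulo 8 one may take
   r = -1, and the diagonal pairs only contribute the residue 0. *)

(** * Primitive roots and quadratic classes modulo a prime *)

Lemma eqr_nat_Fp (p a b : nat) : prime p ->
  ((a%:R : 'F_p) == b%:R) = (a == b %[mod p])%N.
Proof. by move=> p_pr; rewrite -val_eqE /= !val_Fp_nat. Qed.

(** The order of [g] divides [p.-1], and a smaller order would be one of the exponents that
    [is_primroot] excludes. *)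
Lemma primroot_Fp (p g : nat) : prime p -> is_primroot p g ->
  p.-1.-primitive_root (g%:R : 'F_p).
Proof.
move=> p_pr /andP[co_gp /forallP gP].
have p1_gt0 : (0 < p.-1)%N by have := prime_gt1 p_pr; lia.
have tot_p : totient p = p.-1 by rewrite totient_prime.
have gX1 : (g%:R : 'F_p) ^+ p.-1 = 1.
  by apply/eqP; rewrite -natrX -[1]/(1%:R) eqr_nat_Fp // -tot_p Euler_exp_totient.
have [m prim_m m_dv] := prim_order_exists p1_gt0 gX1.
suff -> : p.-1 = m by [].
apply/eqP; rewrite eqn_leq (dvdn_leq p1_gt0 m_dv) andbT leqNgt; apply/negP => m_lt.
rewrite -tot_p in m_lt.
have := gP (Ordinal m_lt); rewrite /= (prim_order_gt0 prim_m) /= => /negP; apply.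
by rewrite -eqr_nat_Fp // natrX (prim_expr_order prim_m).
Qed.

Lemma odd_prime_pred (p : nat) : prime p -> odd p ->
  (1 < p.-1)%N /\ (2 %| p.-1)%N.
Proof. by move=> /prime_gt1; clear; lia. Qed.

Lemma primroot_log (p g x : nat) : prime p -> is_primroot p g ->
  ~~ (p %| x)%N -> exists a, (x = g ^ a %[mod p])%N.
Proof.
move=> p_pr prim_g ndv.
have xX1 : (x%:R : 'F_p) ^+ p.-1 = 1.
  apply/eqP; rewrite -natrX -[1]/(1%:R) eqr_nat_Fp // -totient_prime //.
  by rewrite Euler_exp_totient // coprime_sym prime_coprime.
have [k kE] := prim_rootP (primroot_Fp _ _ p_pr prim_g) xX1.
by exists k; apply/eqP; rewrite -eqr_nat_Fp // kE natrX.
Qed.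

Lemma primroot_ndvd (p g a : nat) : prime p -> is_primroot p g ->
  ~~ (p %| g ^ a)%N.
Proof.
move=> p_pr /andP[co _]; rewrite -prime_coprime // coprime_sym.
exact: coprimeXl.
Qed.

Lemma qr_mod_eqmod (p x y : nat) : (x = y %[mod p])%N -> qr_mod p x = qr_mod p y.
Proof. by rewrite /qr_mod => ->. Qed.

Lemma qclass_eqmod (p x y : nat) b : (x = y %[mod p])%N ->
  qclass p b x = qclass p b y.
Proof. by move=> xy; rewrite /qclass (qr_mod_eqmod _ _ _ xy) xy. Qed.

(** Since [p.-1] is even, exponents of [g] have a well-defined parity: a square root [g ^ b] makes
    [b * 2] and [a] agree modulo [p.-1], hence modulo 2. *)
Lemma qr_mod_primroot_exp (p g a : nat) : prime p -> odd p -> is_primroot p g ->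
  qr_mod p (g ^ a) = ~~ odd a.
Proof.
move=> p_pr p_odd prim_g; have p_gt0 := prime_gt0 p_pr.
rewrite /qr_mod lt0n -/(dvdn p _) primroot_ndvd //=.
apply/existsP/idP => [[y /eqP yE]|a_even].
  have y_ndv : ~~ (p %| y)%N.
    apply: contra (primroot_ndvd p g a p_pr prim_g) => /(dvdn_mull y).
    by rewrite mulnn /dvdn yE.
  have [b bE] := primroot_log p g y p_pr prim_g y_ndv.
  have : (g ^ (b * 2) == g ^ a %[mod p])%N.
    by rewrite -yE expnM -modnXm -bE modnXm.
  rewrite -eqr_nat_Fp // !natrX (eq_prim_root_expr (primroot_Fp _ _ p_pr prim_g)).
  have [_ d2] := odd_prime_pred _ p_pr p_odd.
  move=> /eqP H; have: (b * 2 = a %[mod 2])%N.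
    by rewrite -(modn_dvdm (b * 2) d2) H modn_dvdm.
  by clear; lia.
exists (Ordinal (ltn_pmod (g ^ a./2) p_gt0)) => /=.
by rewrite modnXm -expnM; apply/eqP; congr ((g ^ _) %% p)%N; move: a_even; clear; lia.
Qed.

Lemma qclass_primroot_exp (p g a : nat) b : prime p -> odd p -> is_primroot p g ->
  qclass p b (g ^ a) = (odd a == b).
Proof.
move=> p_pr p_odd prim_g; rewrite /qclass qr_mod_primroot_exp //.
by rewrite lt0n -/(dvdn p _) primroot_ndvd //=; case: odd; case: b.
Qed.

Lemma qclass_dvdF (p x : nat) b : (p %| x)%N -> qclass p b x = false.
Proof. by rewrite /qclass /dvdn => /eqP ->. Qed.

(** In terms of discrete logarithms, multiplying by [r] adds an odd exponent and so flips the
    parity. *)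
Lemma qclass_nonresidueM (p g r x : nat) b :
  prime p -> odd p -> is_primroot p g -> qclass p true r -> ~~ (p %| x)%N ->
  qclass p b (r * x) = ~~ qclass p b x.
Proof.
move=> p_pr p_odd prim_g r_nqr x_ndv.
have r_ndv : ~~ (p %| r)%N by apply: contraL r_nqr => /qclass_dvdF ->.
have [k kE] := primroot_log _ _ _ p_pr prim_g r_ndv.
have [a aE] := primroot_log _ _ _ p_pr prim_g x_ndv.
move: r_nqr; rewrite (qclass_eqmod _ _ _ _ kE) (qclass_eqmod _ _ _ _ aE).
have -> : qclass p b (r * x) = qclass p b (g ^ (k + a)).
  by apply: qclass_eqmod; rewrite expnD -modnMm kE aE modnMm.
rewrite !qclass_primroot_exp // oddD => /eqP ->.
by case: odd; case: b.
Qed.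

(** A square root y of -1 would give 1 = y^(p-1) = (-1)^((p-1)/2) = -1, because (p-1)/2 is odd; then
    p would divide 2. *)
Lemma nonresidue_m1 (p x : nat) : prime p -> (p %% 4 = 3)%N ->
  (p %| x.+1)%N -> qclass p true x.
Proof.
move=> p_pr p4 dv; have p_gt1 := prime_gt1 p_pr.
have nzx : ~~ (p %| x)%N.
  apply/negP => dvx; move: dv; rewrite -addn1 dvdn_addr // dvdn1.
  by apply/negP; lia.
rewrite /qclass lt0n nzx /= eqbF_neg; apply/negP => /andP[_ /existsP[y yE]].
have xN1 : (x%:R : 'F_p) = -1.
  apply/eqP; rewrite -subr_eq0 opprK natr1 -[0]/(0%:R) eqr_nat_Fp //.
  by rewrite mod0n.
have yX2 : (y%:R : 'F_p) ^+ 2 = -1.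
  by rewrite -xN1; apply/eqP; rewrite -natrX eqr_nat_Fp.
have co_y : coprime y p.
  rewrite coprime_sym prime_coprime //; apply: contra nzx => /(dvdn_mull y).
  by rewrite mulnn /dvdn (eqP yE).
have : (y%:R : 'F_p) ^+ p.-1 = 1.
  apply/eqP; rewrite -natrX -[1]/(1%:R) eqr_nat_Fp // -totient_prime //.
  by rewrite Euler_exp_totient.
have -> : p.-1 = (2 * (2 * (p %/ 4)).+1)%N by lia.
rewrite exprM yX2 exprS exprM sqrrN !expr1n => /eqP.
rewrite mulr1 eq_sym -subr_eq0 opprK -[1 + 1]/(2%:R) -[0]/(0%:R) eqr_nat_Fp // mod0n.
move=> /dvdn_leq; lia.
Qed.

(** * Simultaneous congruences and the classes D_0, D_1 *)

Lemma eqn_mod_chinese (a b m1 m2 : nat) : (0 < m1)%N ->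
  (a = b %[mod gcdn m1 m2])%N ->
  exists t, (t = a %[mod m1])%N /\ (t = b %[mod m2])%N.
Proof.
move=> m1_gt0 ab; have [k _ kdv] := Bezoutl m2 m1_gt0.
set d := gcdn m1 m2 in ab kdv.
(* Adding [m1 * b] does not change [a] modulo [m1] and keeps the subtraction of [b] from
   truncating. *)
have le_b : (b <= a + m1 * b)%N by apply: leq_trans (leq_addl _ _); rewrite leq_pmull.
have : (d %| (a + m1 * b) - b)%N.
  rewrite -eqn_mod_dvd //.
  apply/eqP; rewrite -ab -modnDmr -modnMml.
  by have /eqP -> : (d %| m1)%N := dvdn_gcdl _ _; rewrite mul0n mod0n addn0.
case/dvdnP => m mE.
(* Bezout makes [k * m2] congruent to [- d] modulo [m1], and [m1.-1] acts as -1 there; the added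
   term is thus [m * d] modulo [m1] and 0 modulo [m2]. *)
exists (b + m * (m1.-1 * k) * m2)%N; split; last first.
  by rewrite addnC modnMDl.
apply/eqP; rewrite -(eqn_modDr (m1 * b)%N).
have -> : (a + m1 * b = b + m * d)%N by rewrite -mE subnKC.
case/dvdnP: kdv => c cE.
rewrite -(eqn_modDr (m * (k * m2))%N).
have -> : (b + m * d + m * (k * m2) = (m * c) * m1 + b)%N.
  by rewrite -addnA -mulnDr cE; lia.
have -> : (b + m * (m1.-1 * k) * m2 + m1 * b + m * (k * m2) =
          (m * k * m2 + b) * m1 + b)%N by nia.
by rewrite !modnMDl.
Qed.

Lemma expn_eqmod (p g a b : nat) : prime p -> coprime g p ->
  (a = b %[mod p.-1])%N -> (g ^ a = g ^ b %[mod p])%N.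
Proof.
move=> p_pr co_gp ab; rewrite (divn_eq a p.-1) (divn_eq b p.-1) ab.
rewrite !expnD ![(_ * p.-1)%N]mulnC !expnM.
have H k : ((g ^ p.-1) ^ k = 1 %[mod p])%N.
  by rewrite -modnXm -totient_prime // Euler_exp_totient // modnXm exp1n.
by rewrite -modnMml H modnMml -[RHS]modnMml H modnMml.
Qed.

(** The element [g ^ t * nu ^ i] is [g1 ^ (t + i)] modulo [n1] and [g2 ^ t] modulo [n2]. If [x] has
    logarithms [a] and [c] there, one must solve [t + i = a] modulo [n1.-1] and [t = c] modulo
    [n2.-1]. This is possible exactly when [i = a - c] modulo [d], and [t] then has the parity of
    [c]. *)
Lemma cyc_classE (n1 n2 g1 g2 g nu x : nat) b :
  prime n1 -> prime n2 -> odd n1 -> odd n2 -> n1 != n2 ->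
  is_primroot n1 g1 -> is_primroot n2 g2 ->
  (g = g1 %[mod n1])%N -> (g = g2 %[mod n2])%N ->
  (nu = g %[mod n1])%N -> (nu = 1 %[mod n2])%N ->
  let d := gcdn n1.-1 n2.-1 in
  cyc_class (n1 * n2) ((n1.-1 * n2.-1) %/ d) d g nu b x =
  ~~ (n1 %| x)%N && qclass n2 b x.
Proof.
move=> p1 p2 o1 o2 n12 r1 r2 gg1 gg2 nug nu1 d.
set e := (_ %/ d)%N.
have [P1 _] := odd_prime_pred _ p1 o1.
have [P2 ev_n2] := odd_prime_pred _ p2 o2.
have [n1_gt0 n2_gt0] := (ltnW P1, ltnW P2).
have eL : e = lcmn n1.-1 n2.-1 by [].
have d1e : (n1.-1 %| e)%N by rewrite eL dvdn_lcml.
have d2e : (n2.-1 %| e)%N by rewrite eL dvdn_lcmr.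
have e_gt0 : (0 < e)%N by rewrite eL lcmn_gt0 n1_gt0.
have d_gt0 : (0 < d)%N by rewrite gcdn_gt0 n1_gt0.
have co12 : coprime n1 n2 by rewrite prime_coprime // dvdn_prime2.
have e1 t i : (g ^ t * nu ^ i = g1 ^ (t + i) %[mod n1])%N.
  rewrite -modnMm -modnXm -[(nu ^ i %% _)%N]modnXm nug gg1 !modnXm modnMm.
  by rewrite expnD.
have e2 t i : (g ^ t * nu ^ i = g2 ^ t %[mod n2])%N.
  by rewrite -modnMm -modnXm -[(nu ^ i %% _)%N]modnXm nu1 gg2 !modnXm exp1n modnMm muln1.
apply/idP/idP.
  move=> /existsP[s /existsP[i /andP[_ xE]]].
  move: xE; rewrite chinese_remainder // => /andP[/eqP x1 /eqP x2].
  rewrite /dvdn x1 e1 -/(dvdn _ _) primroot_ndvd //=.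
  rewrite (qclass_eqmod _ _ _ _ x2) (qclass_eqmod _ _ _ _ (e2 _ _)).
  by rewrite qclass_primroot_exp // oddD oddM oddb.
move=> /andP[nd1 qx].
have nd2 : ~~ (n2 %| x)%N by apply: contraL qx => /qclass_dvdF ->.
have [a aE] := primroot_log _ _ _ p1 r1 nd1.
have [c cE] := primroot_log _ _ _ p2 r2 nd2.
have /eqP bE : odd c == b.
  by rewrite -(qclass_primroot_exp n2 g2) // -(qclass_eqmod _ _ _ _ cE).
(* The exponent of [nu] is a - c modulo [d], with [d.-1] standing for -1. *)
have lt_i : ((a + d.-1 * c) %% d < d)%N by rewrite ltn_pmod.
set i := (_ %% d)%N in lt_i.
have ic : (i + c = a %[mod d])%N.
  rewrite modnDml -addnA -[X in (_ + (_ + X))%N]mul1n -mulnDl addn1 prednK //.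
  by rewrite addnC mulnC modnMDl.
(* Likewise [n1.-1.-1] acts as -1 modulo [n1.-1], so the first target is a - i. *)
have [|t0 [t1 t2]] := eqn_mod_chinese (a + n1.-1.-1 * i) c n1.-1 n2.-1 (ltnW P1).
  apply/eqP; rewrite -/d -(eqn_modDr i) -addnA -mulSnr prednK //.
  rewrite -modnDmr -modnMml.
  have /eqP -> : (d %| n1.-1)%N := dvdn_gcdl _ _.
  by rewrite mul0n mod0n addn0 addnC; apply/eqP; rewrite -ic addnC.
(* As [e] is the lcm of [n1.-1] and [n2.-1], this reduction preserves both congruences. *)
set t := (t0 %% e)%N.
have lt_t : (t < e)%N by rewrite ltn_pmod.
have ot : odd t = b.
  rewrite -bE; have : (t = c %[mod 2])%N.
    rewrite -(modn_dvdm t ev_n2) -(modn_dvdm c ev_n2) -t2 (modn_dvdm _ d2e).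
    by [].
  by clear; lia.
have tE : (2 * t./2 + b = t)%N by rewrite -ot; clear; lia.
have lt_s : (t./2 < e)%N by move: lt_t; clear; lia.
apply/existsP; exists (Ordinal lt_s); apply/existsP; exists (Ordinal lt_i) => /=.
have ev_e : (2 %| e)%N := dvdn_trans ev_n2 d2e.
apply/andP; split; first by move: ev_e lt_t; clear; lia.
rewrite tE chinese_remainder // e1 e2 aE cE; apply/andP; split; apply/eqP.
  apply: expn_eqmod => //; first by case/andP: r1.
  rewrite -modnDml (modn_dvdm _ d1e) t1 modnDml -addnA -mulSnr prednK //.
  by rewrite addnC mulnC modnMDl.
apply: expn_eqmod => //; first by case/andP: r2.
by rewrite (modn_dvdm _ d2e) t2.
Qed.

(** * Dimension and odd-like words of a cyclic code *)

Lemma poly_rowE (F : fieldType) (n : nat) (p : {poly F}) :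
  poly_row n p = poly_rV p.
Proof. by []. Qed.

(** Used with k = n - deg g: the product then has degree below n, so [poly_rV] cuts nothing off. *)
Definition encode (F : fieldType) (k n : nat) (g : {poly F}) (u : 'rV[F]_k) : 'rV[F]_n :=
  poly_rV (rVpoly u * g).

Lemma encode_is_linear (F : fieldType) (k n : nat) (g : {poly F}) :
  linear (@encode F k n g).
Proof.
by move=> a u v; rewrite /encode !linearP mulrDl -scalerAl linearP.
Qed.

HB.instance Definition _ (F : fieldType) (k n : nat) (g : {poly F}) :=
  GRing.isLinear.Build F 'rV[F]_k 'rV[F]_n _ (@encode F k n g)
    (@encode_is_linear F k n g).

Section CyclicCode.
Variables (F : fieldType) (n : nat) (g : {poly F}).
Hypotheses (n_gt0 : (0 < n)%N) (g_dvd : g %| 'X^n - 1).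

Let k := (n.+1 - size g)%N.

Lemma dvd_Xn_sub1_neq0 : g != 0.
Proof.
apply: contraTneq g_dvd => ->; rewrite dvd0p -size_poly_eq0.
by rewrite size_XnsubC.
Qed.

Lemma dvd_Xn_sub1_size : (size g <= n.+1)%N.
Proof.
rewrite -(size_XnsubC (1 : F) n_gt0) dvdp_leq //.
by rewrite -size_poly_eq0 size_XnsubC.
Qed.

Lemma size_encode (u : 'rV[F]_k) : (size (rVpoly u * g)%R <= n)%N.
Proof.
have sg := dvd_Xn_sub1_size.
apply: leq_trans (size_polyMleq _ _) _.
have : (size (rVpoly u) <= k)%N by apply: size_poly.
have : (0 < size g)%N by rewrite size_poly_gt0 dvd_Xn_sub1_neq0.
by rewrite /k; lia.
Qed.

Lemma encode_inj : injective (@encode F k n g).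
Proof.
move=> u v /(congr1 rVpoly); rewrite !poly_rV_K ?size_encode //.
by move/(mulIf dvd_Xn_sub1_neq0)/(congr1 (@poly_rV F k)); rewrite !rVpolyK.
Qed.

Lemma poly_row_dvd_encode (p : {poly F}) : (size p <= n)%N -> g %| p ->
  poly_row n p \in limg (linfun (@encode F k n g)).
Proof.
move=> sp /dvdpP[h hE]; apply/memv_imgP; exists (poly_rV h); first exact: memvf.
rewrite lfunE /= /encode poly_rV_K ?hE //.
have [-> | h0] := eqVneq h 0; first by rewrite size_poly0.
have : size p = (size h + size g).-1 by rewrite hE size_mul // dvd_Xn_sub1_neq0.
rewrite /k.
have : (0 < size g)%N by rewrite size_poly_gt0 dvd_Xn_sub1_neq0.
by move: sp; lia.
Qed.

Lemma size_modp_Xn_sub1 (p : {poly F}) : (size (p %% ('X^n - 1))%R <= n)%N.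
Proof.
rewrite -ltnS -(size_XnsubC (1 : F) n_gt0) ltn_modp.
by rewrite -size_poly_eq0 size_XnsubC.
Qed.

(** Reduction modulo X^n - 1 preserves multiples of [g], a divisor of X^n - 1. Conversely, the image
    is spanned by the ['X^j * g] with j < k, which are already reduced. *)
Lemma cyclic_codeE : cyclic_code n g = limg (linfun (@encode F k n g)).
Proof.
apply/eqP; rewrite eqEsubv; apply/andP; split.
  apply/span_subvP => _ /mapP[m _ ->]; apply: poly_row_dvd_encode.
    exact: size_modp_Xn_sub1.
  by rewrite -(dvdp_mod _ g_dvd) dvdp_mull.
apply/subvP => _ /memv_imgP[u _ ->]; rewrite lfunE /=.
rewrite [u]matrix_sum_delta linear_sum /=; apply: memv_suml => i _.
rewrite linear_sum /=; apply: memv_suml => j _; rewrite linearZ memvZ //.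
apply: memv_span; apply/mapP; exists (j : nat).
  rewrite mem_iota add0n /=; apply: leq_trans (ltn_ord j) _.
  have : (0 < size g)%N by rewrite size_poly_gt0 dvd_Xn_sub1_neq0.
  by rewrite /k; lia.
have sz := size_encode (delta_mx i j).
rewrite /encode poly_rowE; congr poly_rV.
have rE : rVpoly (delta_mx i j : 'rV[F]_k) = 'X^j by rewrite ord1 rVpoly_delta.
by rewrite rE in sz *; rewrite modp_small // size_XnsubC.
Qed.

Lemma dim_cyclic_code : \dim (cyclic_code n g) = (n.+1 - size g)%N.
Proof.
have /eqP ker0 : lker (linfun (@encode F k n g)) == 0%VS.
  by apply/lker0P => u v; rewrite !lfunE; apply: encode_inj.
by rewrite cyclic_codeE limg_dim_eq ?ker0 ?capv0 // dimvf dim_matrix mul1r.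
Qed.

Lemma cyclic_code_dvdp (c : 'rV[F]_n) : c \in cyclic_code n g -> g %| rVpoly c.
Proof.
rewrite cyclic_codeE => /memv_imgP[u _ ->]; rewrite lfunE /=.
by rewrite poly_rV_K ?size_encode // dvdp_mull.
Qed.

Lemma oddlikeE (c : 'rV[F]_n) : oddlike c = ((rVpoly c).[1] != 0).
Proof.
rewrite (horner_coef_wide _ (size_poly _ _)); congr (_ != 0).
by apply: eq_bigr => i _; rewrite coef_rVpoly_ord expr1n mulr1.
Qed.

(** Ensures that the minimum odd-like weight is taken over a nonempty set. The reduced generator
    serves, since X^n - 1 vanishes at 1. *)
Lemma cyclic_code_oddlike : g.[1] != 0 ->
  exists2 c, c \in cyclic_code n g & oddlike c.
Proof.
move=> g1; exists (poly_row n (g %% ('X^n - 1))).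
  rewrite cyclic_codeE poly_row_dvd_encode ?size_modp_Xn_sub1 //.
  by rewrite -(dvdp_mod _ g_dvd).
rewrite oddlikeE poly_rV_K ?size_modp_Xn_sub1 //.
move: g1; rewrite {1}(divp_eq g ('X^n - 1)) hornerD hornerM.
have -> : ('X^n - 1 : {poly F}).[1] = 0 by rewrite !hornerE expr1n subrr.
by rewrite mulr0 add0r.
Qed.

End CyclicCode.

(** * Support pairs and the square root bound *)

Section SquareRootBound.
Variables (F L : fieldType) (sigma : {rmorphism F -> L}) (n r : nat) (theta : L).
Hypothesis prim : n.-primitive_root theta.

Lemma prim_root_sum_pow (k : nat) : ~~ (n %| k)%N -> \sum_(j < n) theta ^+ (j * k) = 0.
Proof.
rewrite (prim_order_dvd prim) => thk.
under eq_bigr => j _ do rewrite mulnC exprM.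
have thkn : (theta ^+ k) ^+ n = 1 by rewrite exprAC (prim_expr_order prim) expr1n.
have := subrX1 (theta ^+ k) n; rewrite thkn subrr => /esym/eqP.
by rewrite mulf_eq0 subr_eq0 (negPf thk) => /eqP.
Qed.

(* By Fourier inversion, n times the coefficient of x^m in c(x) c(x^r) modulo
   x^n - 1 is c(1)^2. *)
Lemma support_pairs_cover (c : 'rV[F]_n) (m : 'I_n) :
  oddlike c ->
  (forall j, ~~ (n %| j)%N ->
     (map_poly sigma (rVpoly c)).[theta ^+ j] *
     (map_poly sigma (rVpoly c)).[theta ^+ (r * j)] = 0) ->
  exists i1 i2 : 'I_n,
    [/\ c 0 i1 != 0, c 0 i2 != 0 & ((i1 + r * i2) %% n = m)%N].
Proof.
move=> c_odd cvan; have n_gt0 := prim_order_gt0 prim.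
set p := map_poly sigma (rVpoly c) in cvan.
have pE x : p.[x] = \sum_(i < n) sigma (c 0 i) * x ^+ i.
  rewrite (@horner_coef_wide _ n) ?size_map_poly ?size_poly //.
  by apply: eq_bigr => i _; rewrite coef_map coef_rVpoly_ord.
have p1 : p.[1] != 0.
  by rewrite -(rmorph1 sigma) horner_map fmorph_eq0 -oddlikeE.
pose cov := [exists i1 : 'I_n, exists i2 : 'I_n,
   [&& c 0 i1 != 0, c 0 i2 != 0 & ((i1 + r * i2) %% n == m)%N]].
have [/existsP[i1 /existsP[i2 /and3P[? ? /eqP ?]]]|ncov] := boolP cov.
  by exists i1, i2.
(* The factor theta^(j(n-m)) is theta^(-jm), so this is an unnormalised inverse Fourier transform at
   [m]; only j = 0 survives. *)
have : \sum_(j < n) theta ^+ (j * (n - m)) * (p.[theta ^+ j] * p.[theta ^+ (r * j)])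
       = p.[1] * p.[1].
  rewrite (bigD1 (Ordinal n_gt0)) //= mul0n muln0 expr0 mul1r big1 ?addr0 //.
  move=> j j0; rewrite cvan ?mulr0 //; apply: contra j0 => /dvdnP[q qE].
  rewrite -val_eqE /=; have := ltn_ord j; rewrite qE.
  by case: q qE => //= q _; rewrite mulSn; lia.
have -> : \sum_(j < n) theta ^+ (j * (n - m)) * (p.[theta ^+ j] * p.[theta ^+ (r * j)])
  = \sum_(i1 < n) \sum_(i2 < n) sigma (c 0 i1) * sigma (c 0 i2) *
       \sum_(j < n) theta ^+ (j * (n - m + (i1 + r * i2))).
  under [LHS]eq_bigr => j _.
    rewrite !pE big_distrlr /= mulr_sumr.
    under eq_bigr => i1 _ do rewrite mulr_sumr.
    over.
  rewrite exchange_big /=; apply: eq_bigr => i1 _.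
  rewrite exchange_big /=; apply: eq_bigr => i2 _.
  rewrite mulr_sumr; apply: eq_bigr => j _.
  rewrite !mulnDr !exprD -!exprM.
  have -> : (r * j * i2 = j * (r * i2))%N by lia.
  rewrite [LHS]mulrC -!mulrA; congr (_ * _); rewrite [LHS]mulrCA; congr (_ * _).
  by rewrite [RHS]mulrC -!mulrA.
(* If no support pair reaches [m], each term has a zero coefficient or a vanishing sum over [j],
   whence c(1)^2 = 0, against odd-likeness. *)
rewrite big1 => [/esym/eqP|i1 _]; first by rewrite mulf_eq0 (negPf p1).
apply: big1 => i2 _.
have [->|c1] := eqVneq (c 0 i1) 0; first by rewrite rmorph0 !mul0r.
have [->|c2] := eqVneq (c 0 i2) 0; first by rewrite rmorph0 mulr0 mul0r.
rewrite prim_root_sum_pow ?mulr0 //; apply: contra ncov => dv.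
apply/existsP; exists i1; apply/existsP; exists i2; rewrite c1 c2 /=.
have lm := ltn_ord m.
rewrite -[X in _ == X](modn_small lm) -(eqn_modDl (n - m)).
by rewrite subnK ?(ltnW lm) // modnn.
Qed.

Lemma oddlike_wt_sqr (c : 'rV[F]_n) :
  oddlike c ->
  (forall j, ~~ (n %| j)%N ->
     (map_poly sigma (rVpoly c)).[theta ^+ j] *
     (map_poly sigma (rVpoly c)).[theta ^+ (r * j)] = 0) ->
  (n <= hwt c ^ 2)%N.
Proof.
move=> c_odd cvan; set S := [set i : 'I_n | c 0 i != 0].
have n_gt0 := prim_order_gt0 prim.
pose f (x : 'I_n * 'I_n) := Ordinal (ltn_pmod (x.1 + r * x.2) n_gt0).
rewrite -{1}[n]card_ord /hwt -/S -mulnn -cardsX.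
apply: leq_trans (leq_imset_card f _); apply: subset_leq_card.
apply/subsetP => m _; have [i1 [i2 [c1 c2 mE]]] := support_pairs_cover c m c_odd cvan.
apply/imsetP; exists (i1, i2); first by rewrite !inE c1 c2.
exact/val_inj.
Qed.

Lemma oddlike_wt_sqr_m1 (c : 'rV[F]_n) :
  (n %| r.+1)%N -> oddlike c ->
  (forall j, ~~ (n %| j)%N ->
     (map_poly sigma (rVpoly c)).[theta ^+ j] *
     (map_poly sigma (rVpoly c)).[theta ^+ (r * j)] = 0) ->
  (n <= hwt c ^ 2 - hwt c + 1)%N.
Proof.
move=> r_m1 c_odd cvan; set S := [set i : 'I_n | c 0 i != 0].
have n_gt0 := prim_order_gt0 prim.
pose f (x : 'I_n * 'I_n) := Ordinal (ltn_pmod (x.1 + r * x.2) n_gt0).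
pose D := [set (i, i) | i in S].
have cD : #|D| = #|S| by rewrite card_imset // => i j [].
have sD : D \subset setX S S.
  by apply/subsetP => _ /imsetP[i iS ->]; rewrite !inE andbb in iS *.
have -> : (hwt c ^ 2 - hwt c)%N = #|setX S S :\: D|.
  by rewrite cardsD (setIidPr sD) cD cardsX mulnn.
rewrite addn1 -{1}[n]card_ord.
have := leq_imset_card f (setX S S :\: D); rewrite -ltnS; apply: leq_trans.
(* A diagonal pair maps to i(r+1) = 0 modulo n, so adjoining the single residue 0 makes up for all
   of them; this is the +1 of the bound. *)
apply: (@leq_trans #|Ordinal n_gt0 |: f @: (setX S S :\: D)|); last first.
  by rewrite cardsU1 -add1n leq_add2r leq_b1.
apply: subset_leq_card.
apply/subsetP => m _; have [i1 [i2 [c1 c2 mE]]] := support_pairs_cover c m c_odd cvan.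
rewrite in_setU1; have [i12|i12] := eqVneq i1 i2.
  apply/orP; left; rewrite -val_eqE /= -mE i12 -mulSn.
  exact: dvdn_mulr.
apply/orP; right; apply/imsetP; exists (i1, i2); last exact/val_inj.
rewrite !inE c1 c2 !andbT; apply: contra i12 => /imsetP[i _ [-> ->]].
by [].
Qed.

End SquareRootBound.

(** * Zero sets exchanged with their nonzero complement by a multiplier *)

Section SwappedZeros.
Variables (n r : nat) (T : nat -> bool).
Hypotheses (n_gt0 : (0 < n)%N) (co_nr : coprime n r).
Hypotheses (T_mod : forall x, T (x %% n) = T x) (T0 : T 0 = false).
Hypothesis TN : forall x, ~~ (n %| x)%N -> T (r * x) = ~~ T x.

(** Multiplication by [r] permutes the residues, and the preimage of the set A cut out by [T] is the
    complement of A and 0, so |A| = n - 1 - |A|. *)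
Lemma card_swapped : (#|[set x : 'I_n | T x]|.*2.+1 = n)%N.
Proof.
pose f (x : 'I_n) := Ordinal (ltn_pmod (r * x) n_gt0).
have f_inj : injective f.
  move=> x y [xy]; apply/val_inj => /=.
  wlog le_xy : x y xy / (x <= y)%N.
    by move=> W; case/orP: (leq_total x y) => [/W|/W H]; [exact | rewrite H].
  have : (n %| y - x)%N.
    by rewrite -(Gauss_dvdr _ co_nr) mulnBr -eqn_mod_dvd ?leq_mul2l ?le_xy ?orbT // xy.
  have := ltn_ord y; have := ltn_ord x.
  case: (posnP (y - x)%N) => [|gt0]; first by move: le_xy; clear; lia.
  by move=> _ yn /(dvdn_leq gt0); move: gt0 yn; clear; lia.
set A := [set x | _].
have nzE (x : 'I_n) : ~~ (n %| x)%N = (x != Ordinal n_gt0).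
  by rewrite -val_eqE /= /dvdn modn_small.
have fA : f @^-1: A = ~: (Ordinal n_gt0 |: A).
  apply/setP => x; rewrite !inE /= T_mod negb_or -nzE.
  have [dv|/TN //] := boolP (n %| x)%N.
  by rewrite /= -T_mod; have /eqP -> := dvdn_mull r dv.
have := cardsC (Ordinal n_gt0 |: A); rewrite -fA card_preimset.
  by rewrite cardsU1 inE /= T0 card_ord /= -addnn; lia.
exact: f_inj.
Qed.

Variables (L : fieldType) (theta : L).
Hypothesis prim : n.-primitive_root theta.

Definition zeros_poly : {poly L} := \prod_(x < n | T x) ('X - (theta ^+ x)%:P).

(** The degree is (n-1)/2, and [size] is one more. *)
Lemma size_zeros_poly : size zeros_poly = (n + 1)./2.
Proof.
rewrite /zeros_poly -big_filter size_prod_XsubC -sum1_size big_filter sum1_card.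
have := card_swapped; rewrite cardsE; set k := #|_| => <-; clear; lia.
Qed.

Lemma zeros_poly_dvd : zeros_poly %| 'X^n - 1.
Proof.
by rewrite -(factor_Xn_sub_1 prim) big_mkord (bigID (fun x : 'I_n => T x)) /= dvdp_mulr.
Qed.

Lemma root_zeros_poly j : T j -> root zeros_poly (theta ^+ j).
Proof.
move=> Tj; rewrite -(prim_expr_mod prim) /root /zeros_poly.
have Tx : T (Ordinal (ltn_pmod j n_gt0)) by rewrite /= T_mod.
by rewrite (bigD1 _ Tx) /= hornerM hornerXsubC subrr mul0r.
Qed.

Lemma zeros_poly_1 : zeros_poly.[1] != 0.
Proof.
rewrite horner_prod; apply/prodf_neq0 => x Tx; rewrite hornerXsubC subr_eq0.
rewrite eq_sym -(prim_order_dvd prim); apply: contraTN Tx => dv.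
by rewrite -T_mod; have /eqP -> := dv; rewrite T0.
Qed.

(** One of [j] and [r * j] lies in [T], so [p] vanishes at one of the two points. *)
Lemma zeros_poly_swap (p : {poly L}) j : zeros_poly %| p -> ~~ (n %| j)%N ->
  p.[theta ^+ j] * p.[theta ^+ (r * j)] = 0.
Proof.
move=> /dvdpP[s ->] /TN Trj.
have [Tj|nTj] := boolP (T j).
  by have /rootP z := root_zeros_poly _ Tj; rewrite !hornerM z mulr0 mul0r.
have /root_zeros_poly/rootP z : T (r * j) by rewrite Trj.
by rewrite !hornerM z !mulr0.
Qed.

End SwappedZeros.

(** * The zero set of the product of the three generator factors *)

(* The exponents of the zeros of the code D_(i,j,h). *)
Definition zero_exp (n1 n2 : nat) (i j h : bool) (x : nat) : bool :=
  [|| ~~ (n1 %| x)%N && qclass n2 i x, (n2 %| x)%N && qclass n1 j (x %/ n2)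
    | (n1 %| x)%N && qclass n2 h (x %/ n1)].

Lemma zero_exp_mod (n1 n2 : nat) (i j h : bool) (x : nat) :
  (0 < n1)%N -> (0 < n2)%N ->
  zero_exp n1 n2 i j h (x %% (n1 * n2)) = zero_exp n1 n2 i j h x.
Proof.
move=> n1_gt0 n2_gt0; rewrite {2}(divn_eq x (n1 * n2)).
set q := (x %/ _)%N; set y := (x %% _)%N; rewrite /zero_exp.
have q1 : (q * (n1 * n2) = (q * n2) * n1)%N by rewrite -mulnA [(n2 * n1)%N]mulnC.
have q2 : (q * (n1 * n2) = (q * n1) * n2)%N by rewrite mulnA.
have z1 : (q * (n1 * n2) + y = y %[mod n1])%N by rewrite q1 modnMDl.
have z2 : (q * (n1 * n2) + y = y %[mod n2])%N by rewrite q2 modnMDl.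
have d1 : ((q * (n1 * n2) + y) %/ n1 = y %/ n1 %[mod n2])%N.
  by rewrite q1 divnMDl // modnMDl.
have d2 : ((q * (n1 * n2) + y) %/ n2 = y %/ n2 %[mod n1])%N.
  by rewrite q2 divnMDl // modnMDl.
by rewrite /dvdn z1 z2 (qclass_eqmod _ _ _ _ z2) (qclass_eqmod _ _ _ _ d1)
  (qclass_eqmod _ _ _ _ d2).
Qed.

(** Nonzero residues are units, multiples of [n2] only, or multiples of [n1] only. On each kind a
    single clause of [zero_exp] is active, and [r] flips its quadratic class. *)
Lemma zero_exp_nonresidueM (n1 n2 g1 g2 r : nat) (i j h : bool) (x : nat) :
  prime n1 -> prime n2 -> odd n1 -> odd n2 -> n1 != n2 ->
  is_primroot n1 g1 -> is_primroot n2 g2 ->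
  qclass n1 true r -> qclass n2 true r -> ~~ (n1 * n2 %| x)%N ->
  zero_exp n1 n2 i j h (r * x) = ~~ zero_exp n1 n2 i j h x.
Proof.
move=> p1 p2 o1 o2 n12 r1 r2 nr1 nr2.
have co12 : coprime n1 n2 by rewrite prime_coprime // dvdn_prime2.
have co1 : coprime n1 r by rewrite prime_coprime //; apply: contraL nr1 => /qclass_dvdF ->.
have co2 : coprime n2 r by rewrite prime_coprime //; apply: contraL nr2 => /qclass_dvdF ->.
rewrite Gauss_dvd // /zero_exp !Gauss_dvdr // negb_and.
have [dv1|nd1] := boolP (n1 %| x)%N; have [dv2|nd2] //= := boolP (n2 %| x)%N => _.
- rewrite -muln_divA // (qclass_nonresidueM n2 g2) //.
  by apply: contra nd2 => dv; rewrite -(divnK dv1) dvdn_mulr.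
- rewrite !orbF (qclass_dvdF n2 x) // (qclass_dvdF n2 (r * x)) ?dvdn_mull //=.
  rewrite -muln_divA // (qclass_nonresidueM n1 g1) //.
  by apply: contra nd1 => dv; rewrite -(divnK dv2) dvdn_mulr.
- by rewrite !orbF (qclass_nonresidueM n2 g2).
Qed.

(** Serves to rewrite both [dpoly_p] factors as products over exponents below [n1 * n2], like
    [dpoly]. *)
Lemma prod_dvdn_ord (R : comNzRingType) (m p n : nat) (P : nat -> bool) (G : nat -> R) :
  (0 < m)%N -> n = (m * p)%N ->
  \prod_(x < n | (m %| x)%N && P (x %/ m)%N) G x = \prod_(k < p | P k) G (m * k)%N.
Proof.
move=> m_gt0 ->.
have lt1 (k : 'I_p) : (m * k < m * p)%N by rewrite ltn_pmul2l.
have lt2 (x : 'I_(m * p)) : (x %/ m < p)%N by rewrite ltn_divLR // [(p * m)%N]mulnC.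
rewrite (reindex_onto (fun k => Ordinal (lt1 k)) (fun x => Ordinal (lt2 x))) /=.
  apply: eq_bigl => k; rewrite dvdn_mulr // -val_eqE /= mulKn // eqxx.
  by rewrite andbT.
by move=> x /andP[dv _]; apply/val_inj; rewrite /= mulnC divnK.
Qed.

Lemma dpoly_zeros_poly (L : fieldType) (theta : L) (n1 n2 g1 g2 g nu : nat) (i j h : bool) :
  prime n1 -> prime n2 -> odd n1 -> odd n2 -> n1 != n2 ->
  is_primroot n1 g1 -> is_primroot n2 g2 ->
  (g = g1 %[mod n1])%N -> (g = g2 %[mod n2])%N ->
  (nu = g %[mod n1])%N -> (nu = 1 %[mod n2])%N ->
  let d := gcdn n1.-1 n2.-1 in
  dpoly (n1 * n2) ((n1.-1 * n2.-1) %/ d) d g nu theta i *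
    dpoly_p n1 n2 theta j * dpoly_p n2 n1 theta h =
  zeros_poly (n1 * n2) (zero_exp n1 n2 i j h) L theta.
Proof.
move=> p1 p2 o1 o2 n12 r1 r2 gg1 gg2 nug nu1 d.
have co12 : coprime n1 n2 by rewrite prime_coprime // dvdn_prime2.
rewrite /dpoly /dpoly_p /zeros_poly.
rewrite -(prod_dvdn_ord _ n2 n1 (n1 * n2) (qclass n1 j) (fun x => 'X - (theta ^+ x)%:P)
  (prime_gt0 p2) (mulnC n1 n2)).
rewrite -(prod_dvdn_ord _ n1 n2 (n1 * n2) (qclass n2 h) (fun x => 'X - (theta ^+ x)%:P)
  (prime_gt0 p1) erefl).
(* With the filters turned into conditional factors, the identity is checked one exponent at a
   time. *)
rewrite [RHS]big_mkcond [X in X * _ * _]big_mkcond [X in _ * X * _]big_mkcond [X in _ * _ * X]big_mkcond -!big_split /=; apply: eq_bigr => x _.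
rewrite (cyc_classE n1 n2 g1 g2) // /zero_exp.
have [dv1|nd1] := boolP (n1 %| x)%N; have [dv2|nd2] //= := boolP (n2 %| x)%N.
(* Here x is 0 modulo both primes: the quotients by [n1] and [n2] are still divisible by the other
   prime and lie in no class. *)
- rewrite !(@qclass_dvdF _ _ _) /= ?mul1r //.
    by rewrite dvdn_divRL // mulnC Gauss_dvd // dv1.
  by rewrite dvdn_divRL // Gauss_dvd // dv1.
- by rewrite !mul1r.
- by rewrite (qclass_dvdF n2 x) //= orbF mul1r mulr1.
- by rewrite !orbF !mulr1.
Qed.

(** * Minimum odd-like weight and parameters of the codes *)

(** The minimum starts from the default value [n], hence the separate premise [P n]. *)
Lemma min_oddlike_wt_ind (F : finFieldType) (n : nat) (C : {vspace 'rV[F]_n}) (P : nat -> Prop) :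
  P n -> (forall c, c \in C -> oddlike c -> P (hwt c)) -> P (min_oddlike_wt C).
Proof.
move=> Pn PC; apply: (big_ind P) => //.
  by move=> x y Px Py; rewrite /minn; case: ifP.
by move=> c /andP[]; apply: PC.
Qed.

Theorem mainTheorem9 (F L : finFieldType) (sigma : {rmorphism F -> L})
    (n1 n2 g1 g2 g nu : nat) (theta : L) :
  prime n1 -> prime n2 -> odd n1 -> odd n2 -> n1 != n2 ->
  let n := (n1 * n2)%N in
  let d := gcdn n1.-1 n2.-1 in
  let e := ((n1.-1 * n2.-1) %/ d)%N in
  coprime #|F| n ->
  is_primroot n1 g1 -> is_primroot n2 g2 ->
  g = g1 %[mod n1] -> g = g2 %[mod n2] ->
  nu = g %[mod n1] -> nu = 1 %[mod n2] ->
  n.-primitive_root theta ->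
  cyc_class n e d g nu false #|F| ->
  qr_mod n1 #|F| -> qr_mod n2 #|F| ->
  forall (i j h : bool) (gF : {poly F}),
    map_poly sigma gF =
      dpoly n e d g nu theta i * dpoly_p n1 n2 theta j * dpoly_p n2 n1 theta h ->
    let C := cyclic_code n gF in
    [/\ \dim C = (n + 1)./2,
        exists2 c, c \in C & oddlike c,
        (n <= (min_oddlike_wt C) ^ 2)%N
      & (n1 %% 8 = 7 -> n2 %% 8 = 7 ->
           n <= (min_oddlike_wt C) ^ 2 - min_oddlike_wt C + 1)%N].
Proof.
move=> p1 p2 o1 o2 n12 n d e _ r1 r2 gg1 gg2 nug nu1 prim _ _ _ i j h gF.
rewrite (dpoly_zeros_poly L theta n1 n2 g1 g2) // -/n => gFE C.
have [n1_gt0 n2_gt0] := (prime_gt0 p1, prime_gt0 p2).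
have co12 : coprime n1 n2 by rewrite prime_coprime // dvdn_prime2.
have n_gt0 : (0 < n)%N by rewrite muln_gt0 n1_gt0.
pose T := zero_exp n1 n2 i j h.
have T_mod x : T (x %% n)%N = T x by apply: zero_exp_mod.
have T0 : T 0%N = false by rewrite /T /zero_exp !dvdn0 !div0n !qclass_dvdF ?dvdn0.
have nonresidue_swap r : qclass n1 true r -> qclass n2 true r ->
    coprime n r /\ (forall x, ~~ (n %| x)%N -> T (r * x)%N = ~~ T x).
  move=> nr1 nr2; split; last by move=> x; apply: (zero_exp_nonresidueM n1 n2 g1 g2).
  rewrite /n coprimeMl !prime_coprime //; apply/andP.
  by split; [apply: contraL nr1 | apply: contraL nr2] => /qclass_dvdF ->.
(* A primitive root is its own first power, and the exponent 1 is odd. *)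
have nonres_g p gp : prime p -> odd p -> is_primroot p gp -> g = gp %[mod p] ->
    qclass p true g.
  move=> pp po rp gE; rewrite (qclass_eqmod p g (gp ^ 1)) ?expn1 //.
  by rewrite -[gp]expn1 qclass_primroot_exp.
have [co_g g_swap] := nonresidue_swap g (nonres_g _ _ p1 o1 r1 gg1) (nonres_g _ _ p2 o2 r2 gg2).
have gF_dvd : gF %| 'X^n - 1.
  rewrite -(dvdp_map sigma) gFE rmorphB rmorph1 /= map_polyXn.
  exact: zeros_poly_dvd.
have gF_1 : gF.[1] != 0.
  rewrite -(fmorph_eq0 sigma) -horner_map rmorph1 gFE.
  exact: (zeros_poly_1 n T).
have C_swap r c : c \in C -> (forall x, ~~ (n %| x)%N -> T (r * x)%N = ~~ T x) ->
    forall k, ~~ (n %| k)%N ->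
     (map_poly sigma (rVpoly c)).[theta ^+ k] *
     (map_poly sigma (rVpoly c)).[theta ^+ (r * k)] = 0.
  move=> cC r_swap k; apply: (zeros_poly_swap n r T) => //.
  by rewrite -/T in gFE; rewrite -gFE dvdp_map; apply: cyclic_code_dvdp.
split.
(* As n is odd, n + 1 - (n+1)/2 is again (n+1)/2. *)
- rewrite dim_cyclic_code // -(size_map_poly sigma) gFE (size_zeros_poly n g) //.
  have : odd n by rewrite /n oddM o1 o2.
  by clear; lia.
- exact: cyclic_code_oddlike.
- apply: (min_oddlike_wt_ind _ _ C (fun w => n <= w ^ 2)%N).
    by rewrite leq_pmulr.
  move=> c cC codd; apply: (oddlike_wt_sqr _ _ sigma _ g _ prim) => //.
  exact: C_swap.
move=> n1_8 n2_8.
(* [n.-1] represents -1 modulo both primes, and 7 modulo 8 is 3 modulo 4, where -1 is a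
   nonresidue. *)
have m1_swap : forall x, ~~ (n %| x)%N -> T (n.-1 * x)%N = ~~ T x.
  apply: (nonresidue_swap _ _ _).2; apply: nonresidue_m1 => //.
  - by move: n1_8; clear; lia.
  - by rewrite prednK // dvdn_mulr.
  - by move: n2_8; clear; lia.
  - by rewrite prednK // dvdn_mull.
apply: (min_oddlike_wt_ind _ _ C (fun w => n <= w ^ 2 - w + 1)%N).
  by move: n_gt0; clear; nia.
move=> c cC codd; apply: (oddlike_wt_sqr_m1 _ _ sigma _ n.-1 _ prim) => //.
  by rewrite prednK.
exact: C_swap.
Qed.
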